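(* Let $P\colon \mathcal{C}^{\mathrm{op}}\to \mathsf{InfSl}$ be a full tripos. Then the following conditions are equivalent: 1. $P$ is $\exists$-supercompactifiable; 2. $\mathcal{C}$ has weak dependent products and a generic proof; 3. the weak subobject doctrine $\Psi_{\mathcal{C}}\colon\mathcal{C}^{\mathrm{op}}\to\mathsf{InfSl}$ is a full tripos.
   Context: A lex primary doctrine is a functor $P\colon \mathcal{C}^{\mathrm{op}}\to\mathsf{InfSl}$, where $\mathcal{C}$ has finite limits and $\mathsf{InfSl}$ is the category of inf-semilattices (posets with finite meets, including top) and their homomorphisms. For $f\colon A\to B$ write $P_f\colon P(B)\to P(A)$. $P$ is full existential if for every arrow $f$ of $\mathcal{C}$ the map $P_f$ has a left adjoint $\exists_f$, satisfying Beck–Chevalley (for pullback squares) and Frobenius reciprocity. $P$ is a full first-order hyperdoctrine if it is full existential, each $P(A)$ is a Heyting algebra, each $P_f$ is a Heyting algebra homomorphism, and each $P_f$ also has a right adjoint $\forall_f$, these satisfying Beck–Chevalley. $P$ has weak power objects if for every object $X$ there are an object $\mathrm{P}X$ and an element $\in_X\in P(X\times\mathrm{P}X)$ such that for every object $Y$ and $\beta\in P(X\times Y)$ there is an arrow $\{\beta\}_X\colon Y\to\mathrm{P}X$ with $\beta=P_{\mathrm{id}_X\times\{\beta\}_X}(\in_X)$. A full tripos is a full first-order hyperdoctrine with weak power objects. Category of points $\mathcal{G}_P$: objects are pairs $(A,\alpha)$ with $\alpha\in P(A)$; arrows $(A,\alpha)\to(B,\beta)$ are arrows $f\colon A\to B$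 of $\mathcal{C}$ with $\alpha\le P_f(\beta)$. It has finite limits. Weak subobject doctrine $\Psi_{\mathcal{C}}$: $\Psi_{\mathcal{C}}(A)$ is the poset reflection of the slice $\mathcal{C}/A$, with reindexing by pullback. Weak dependent products: a weak dependent product of $f\colon X\to J$ along $g\colon J\to I$ consists of an arrow $h\colon Z\to I$ and an arrow $e\colon E\to X$, where $E$ is the pullback of $g$ and $h$, such that $fe$ is the projection $E\to J$, and such that for any other such data $h'\colon Z'\to I$, $e'\colon E'\to X$ (with $E'$ the pullback of $g$ and $h'$, and $fe'$ the projection $E'\to J$) there is $w\colon Z'\to Z$ with $h'=hw$ and $e'=ek$, where $k\colon E'\to E$ is induced by $w$. A category has weak dependent products if these exist for all such $f,g$. Generic proof: an arrow $\theta\colon\Theta\to\Lambda$ such that for every arrow $f\colon Y\to X$ there is $\upsilon_f\colon X\to\Lambda$ such that $f$ factors through the pullback $\upsilon_f^*\theta$ of $\theta$ along $\upsilon_f$ and $\upsilon_f^*\theta$ factors through $f$. A lex primary doctrine $P$ is $\exists$-supercompactifiable if $\mathcal{G}_P$ has weak dependent products and a generic proof. *)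

(* Defs.v *)
From HB Require Import structures.
From mathcomp Require Import all_boot all_order generic_quotient boolp.

Set Implicit Arguments.
Unset Strict Implicit.
Unset Printing Implicit Defensive.

Import Order.TTheory.
Local Open Scope order_scope.

Declare Scope category_scope.
Delimit Scope category_scope with cat.
Local Open Scope category_scope.
Reserved Notation "g ∘ f" (at level 40, left associativity).

Record category := Category {
  ob :> Type;
  hom : ob -> ob -> Type;
  idm : forall A, hom A A;
  compm : forall A B D, hom B D -> hom A B -> hom A D;
  comp1m : forall A B (f : hom A B), compm (idm B) f = f;
  compm1 : forall A B (f : hom A B), compm f (idm A) = f;
  compA : forall A B D E (h : hom D E) (g : hom B D) (f : hom A B),
    compm h (compm g f) = compm (compm h g) f
}.
Arguments idm {c} A.
Notation "g ∘ f" := (compm g f) : category_scope.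

(* The square    W --q--> B
                 |p       |g
                 A --f--> D     is a pullback. *)
Definition is_pullback (C : category) (A B D W : C) (f : hom A D) (g : hom B D)
    (p : hom W A) (q : hom W B) : Prop :=
  f ∘ p = g ∘ q /\
  forall (V : C) (u : hom V A) (v : hom V B), f ∘ u = g ∘ v ->
    exists! k : hom V W, p ∘ k = u /\ q ∘ k = v.

(* Finite limits as chosen structure: terminal object, binary products and
   pullbacks. *)
Record lexCategory := LexCategory {
  lex_cat :> category;
  termo : lex_cat;
  bang : forall A, hom A termo;
  bang_uniq : forall A (f : hom A termo), f = bang A;
  bprod : lex_cat -> lex_cat -> lex_cat;
  pr1 : forall X Y, hom (bprod X Y) X;
  pr2 : forall X Y, hom (bprod X Y) Y;
  pairm : forall W X Y, hom W X -> hom W Y -> hom W (bprod X Y);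
  pr1_pairm : forall W X Y (u : hom W X) (v : hom W Y), pr1 X Y ∘ pairm u v = u;
  pr2_pairm : forall W X Y (u : hom W X) (v : hom W Y), pr2 X Y ∘ pairm u v = v;
  pairm_uniq : forall W X Y (k : hom W (bprod X Y)),
    k = pairm (pr1 X Y ∘ k) (pr2 X Y ∘ k);
  pb : forall A B D : lex_cat, hom A D -> hom B D -> lex_cat;
  pb1 : forall (A B D : lex_cat) (f : hom A D) (g : hom B D), hom (pb f g) A;
  pb2 : forall (A B D : lex_cat) (f : hom A D) (g : hom B D), hom (pb f g) B;
  pbP : forall (A B D : lex_cat) (f : hom A D) (g : hom B D),
    is_pullback f g (pb1 f g) (pb2 f g)
}.
Arguments pr1 {l} X Y.
Arguments pr2 {l} X Y.
Arguments pb1 {l A B D} f g.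
Arguments pb2 {l A B D} f g.

Definition prod_map (C : lexCategory) (X X' Y Y' : C)
    (f : hom X X') (g : hom Y Y') : hom (bprod X Y) (bprod X' Y') :=
  pairm (f ∘ pr1 X Y) (g ∘ pr2 X Y).

(* Inf-semilattices are meet-semilattices with top, [tMeetSemilatticeType]. *)
Record lexDoctrine (d : Order.disp_t) (C : lexCategory) := LexDoctrine {
  fib :> C -> tMeetSemilatticeType d;
  reidx : forall A B : C, hom A B -> fib B -> fib A;
  reidx_id : forall A (a : fib A), reidx (idm A) a = a;
  reidx_comp : forall A B D (g : hom B D) (f : hom A B) (a : fib D),
    reidx (g ∘ f) a = reidx f (reidx g a);
  reidxT : forall A B (f : hom A B), reidx f \top = \top;
  reidxI : forall A B (f : hom A B) (x y : fib B),
    reidx f (x `&` y) = reidx f x `&` reidx f y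
}.
Arguments reidx {d C} P {A B} f x : rename.

Definition is_bottom d (T : porderType d) (z : T) : Prop :=
  forall w : T, z <= w.
Definition is_join d (T : porderType d) (x y z : T) : Prop :=
  forall w : T, (z <= w) = (x <= w) && (y <= w).
Definition is_impl d (T : meetSemilatticeType d) (x y z : T) : Prop :=
  forall w : T, (w <= z) = (w `&` x <= y).

Definition heyting_algebra d (T : tMeetSemilatticeType d) : Prop :=
  [/\ exists z : T, is_bottom z,
      forall x y : T, exists z : T, is_join x y z &
      forall x y : T, exists z : T, is_impl x y z].

(* Bottom, joins and implications are unique when they exist, so a morphism
   preserves the operations iff it preserves these defining properties. *)
Definition heyting_morphism d d' (T : tMeetSemilatticeType d)
    (T' : tMeetSemilatticeType d') (f : T -> T') : Prop :=
  [/\ f \top = \top,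
      forall x y, f (x `&` y) = f x `&` f y,
      forall z, is_bottom z -> is_bottom (f z),
      forall x y z, is_join x y z -> is_join (f x) (f y) (f z) &
      forall x y z, is_impl x y z -> is_impl (f x) (f y) (f z)].

Definition adjoint d d' (T : porderType d) (T' : porderType d')
    (l : T -> T') (r : T' -> T) : Prop :=
  forall x y, (l x <= y) = (x <= r y).

Section Doctrines.
Context (d : Order.disp_t) (C : lexCategory) (P : lexDoctrine d C).

Definition quantifier := forall A B : C, hom A B -> P A -> P B.

Definition beck_chevalley (Q : quantifier) : Prop :=
  forall (A B D W : C) (f : hom A D) (g : hom B D) (p : hom W A) (q : hom W B),
    is_pullback f g p q ->
    forall a : P A, reidx P g (Q A D f a) = Q W B q (reidx P p a).

Definition frobenius (Q : quantifier) : Prop :=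
  forall (A B : C) (f : hom A B) (a : P A) (b : P B),
    Q A B f (reidx P f b `&` a) = b `&` Q A B f a.

Definition full_existential : Prop :=
  exists ex : quantifier,
    [/\ forall (A B : C) (f : hom A B), adjoint (ex A B f) (reidx P f),
        beck_chevalley ex & frobenius ex].

Definition full_hyperdoctrine : Prop :=
  [/\ full_existential,
      forall A : C, heyting_algebra (P A),
      forall (A B : C) (f : hom A B), heyting_morphism (reidx P f) &
      exists al : quantifier,
        (forall (A B : C) (f : hom A B), adjoint (reidx P f) (al A B f)) /\
        beck_chevalley al].

Definition weak_power_objects : Prop :=
  forall X : C, exists (PX : C) (inX : P (bprod X PX)),
    forall (Y : C) (b : P (bprod X Y)), exists chi : hom Y PX,
      b = reidx P (prod_map (idm X) chi) inX.

Definition full_tripos : Prop := full_hyperdoctrine /\ weak_power_objects.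

Definition point_ob := {A : C & P A}.
Definition point_hom (a b : point_ob) :=
  {f : hom (tag a) (tag b) | tagged a <= reidx P f (tagged b)}.

Lemma point_id_subproof (a : point_ob) :
  tagged a <= reidx P (idm (tag a)) (tagged a).
Proof. by rewrite reidx_id. Qed.

Lemma point_comp_subproof (a b c : point_ob) (g : point_hom b c)
    (f : point_hom a b) :
  tagged a <= reidx P (val g ∘ val f) (tagged c).
Proof.
rewrite reidx_comp (le_trans (valP f))//.
by apply/meet_idPl; rewrite -reidxI (meet_l (valP g)).
Qed.

Definition point_id (a : point_ob) : point_hom a a :=
  exist (fun f : hom _ _ => _ <= reidx P f _) _ (point_id_subproof a).
Definition point_comp (a b c : point_ob) (g : point_hom b c)
    (f : point_hom a b) : point_hom a c :=
  exist (fun f : hom _ _ => _ <= reidx P f _) _ (point_comp_subproof g f).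

Definition points : category.
Proof.
apply: (@Category point_ob point_hom point_id point_comp).
- by move=> a b f; apply: val_inj; rewrite /= comp1m.
- by move=> a b f; apply: val_inj; rewrite /= compm1.
- by move=> a b c e h g f; apply: val_inj; rewrite /= compA.
Defined.

End Doctrines.

Section WeakStructure.
Variable C : category.

(* [h] and [e], where [E], [p], [q] is a pullback of [g] and [h]. *)
Definition dep_product_data (X J I : C) (f : hom X J) (g : hom J I)
    (Z E : C) (h : hom Z I) (p : hom E J) (q : hom E Z) (e : hom E X) : Prop :=
  is_pullback g h p q /\ f ∘ e = p.

Definition is_weak_dep_product (X J I : C) (f : hom X J) (g : hom J I)
    (Z E : C) (h : hom Z I) (p : hom E J) (q : hom E Z) (e : hom E X) : Prop :=
  dep_product_data f g h p q e /\
  forall (Z' E' : C) (h' : hom Z' I) (p' : hom E' J) (q' : hom E' Z')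
    (e' : hom E' X), dep_product_data f g h' p' q' e' ->
  exists (w : hom Z' Z) (k : hom E' E),
    [/\ h' = h ∘ w, p ∘ k = p', q ∘ k = w ∘ q' & e' = e ∘ k].

Definition weak_dependent_products : Prop :=
  forall (X J I : C) (f : hom X J) (g : hom J I),
  exists (Z E : C) (h : hom Z I) (p : hom E J) (q : hom E Z) (e : hom E X),
    is_weak_dep_product f g h p q e.

Definition generic_proof (Theta Lambda : C) (theta : hom Theta Lambda) : Prop :=
  forall (Y X : C) (f : hom Y X),
  exists (u : hom X Lambda) (E : C) (p : hom E X) (q : hom E Theta),
    [/\ is_pullback u theta p q,
        exists k : hom Y E, f = p ∘ k &
        exists l : hom E Y, p = f ∘ l].

Definition has_generic_proof : Prop :=
  exists (Theta Lambda : C) (theta : hom Theta Lambda), generic_proof theta.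

End WeakStructure.

Definition ex_supercompactifiable d (C : lexCategory) (P : lexDoctrine d C) :=
  weak_dependent_products (points P) /\ has_generic_proof (points P).

Section WeakSubobjects.
Variable C : lexCategory.

Record slice (A : C) := Slice { slice_ob : C; slice_map : hom slice_ob A }.

HB.instance Definition _ (A : C) := gen_eqMixin (slice A).
HB.instance Definition _ (A : C) := gen_choiceMixin (slice A).

Section Fiber.
Variable A : C.
Implicit Types x y z : slice A.

Definition slice_le x y : bool :=
  `[< exists k : hom (slice_ob x) (slice_ob y),
        slice_map y ∘ k = slice_map x >].

Lemma slice_le_refl : reflexive slice_le.
Proof. by move=> x; apply/asboolP; exists (idm _); rewrite compm1. Qed.

Lemma slice_le_trans : transitive slice_le.
Proof.
move=> y x z /asboolP[k kE] /asboolP[l lE]; apply/asboolP.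
by exists (l ∘ k); rewrite compA lE kE.
Qed.

Definition slice_equiv : rel (slice A) :=
  fun x y => slice_le x y && slice_le y x.

Lemma slice_equiv_refl : reflexive slice_equiv.
Proof. by move=> x; rewrite /slice_equiv slice_le_refl. Qed.

Lemma slice_equiv_sym : symmetric slice_equiv.
Proof. by move=> x y; rewrite /slice_equiv andbC. Qed.

Lemma slice_equiv_trans : transitive slice_equiv.
Proof.
move=> y x z /andP[xy yx] /andP[yz zy].
by rewrite /slice_equiv (slice_le_trans xy yz) (slice_le_trans zy yx).
Qed.

Canonical slice_equiv_rel :=
  EquivRel slice_equiv slice_equiv_refl slice_equiv_sym slice_equiv_trans.

(* The poset reflection of the slice over [A]. *)
Definition wsub := {eq_quot slice_equiv}%qT.
HB.instance Definition _ := Choice.on wsub.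
HB.instance Definition _ := EqQuotient.on wsub.

Definition wsub_le (x y : wsub) : bool := slice_le (repr x) (repr y).

Definition slice_meet x y : slice A :=
  Slice (slice_map x ∘ pb1 (slice_map x) (slice_map y)).
Definition wsub_meet (x y : wsub) : wsub :=
  \pi_wsub%qT (slice_meet (repr x) (repr y)).
Definition wsub_top : wsub := \pi_wsub%qT (Slice (idm A)).

Lemma slice_le_repr x y :
  slice_le (repr (\pi_wsub%qT x)) (repr (\pi_wsub%qT y)) = slice_le x y.
Proof.
have E z : slice_equiv (repr (\pi_wsub%qT z)) z.
  by apply/eqmodP; rewrite reprK.
have [/andP[x1 x2] /andP[y1 y2]] := (E x, E y).
apply/idP/idP => H; first exact: slice_le_trans (slice_le_trans x2 H) y1.
exact: slice_le_trans (slice_le_trans x1 H) y2.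
Qed.

Lemma wsub_lepi x y : wsub_le (\pi_wsub%qT x) (\pi_wsub%qT y) = slice_le x y.
Proof. exact: slice_le_repr. Qed.

Lemma wsub_le_refl : reflexive wsub_le.
Proof. by move=> x; apply: slice_le_refl. Qed.

Lemma wsub_le_anti : antisymmetric wsub_le.
Proof.
move=> x y xy; rewrite -[x]reprK -[y]reprK.
exact/eqmodP.
Qed.

Lemma wsub_le_trans : transitive wsub_le.
Proof. by move=> y x z; apply: slice_le_trans. Qed.

HB.instance Definition _ := @Order.Le_isPOrder.Build (Order.Disp tt tt) wsub
  wsub_le wsub_le_refl wsub_le_anti wsub_le_trans.

Lemma slice_lexI x y z :
  slice_le x (slice_meet y z) = slice_le x y && slice_le x z.
Proof.
have [sq up] := pbP (slice_map y) (slice_map z).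
apply/asboolP/andP => /= [[k kE]|[/asboolP[k kE] /asboolP[l lE]]].
  split; apply/asboolP.
    by exists (pb1 _ _ ∘ k); rewrite compA.
  by exists (pb2 _ _ ∘ k); rewrite compA -sq.
have [m [[m1 m2] _]] := up _ k l (etrans kE (esym lE)).
by exists m; rewrite -compA m1.
Qed.

Lemma wsub_lexI (x y z : wsub) :
  (x <= wsub_meet y z) = (x <= y) && (x <= z).
Proof.
rewrite -{1}[x]reprK.
transitivity (slice_le (repr x) (slice_meet (repr y) (repr z))).
  exact: wsub_lepi.
exact: slice_lexI.
Qed.

HB.instance Definition _ :=
  @Order.POrder_isMeetSemilattice.Build _ wsub wsub_meet wsub_lexI.

Lemma wsub_lex1 (x : wsub) : x <= wsub_top.
Proof.
rewrite -[x]reprK.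
have -> : (\pi_wsub%qT (repr x) <= wsub_top) = slice_le (repr x) (Slice (idm A)).
  exact: wsub_lepi.
by apply/asboolP; exists (slice_map (repr x)); rewrite comp1m.
Qed.

HB.instance Definition _ :=
  @Order.hasTop.Build _ wsub wsub_top wsub_lex1.

End Fiber.

Definition slice_reidx (A B : C) (f : hom A B) (x : slice B) : slice A :=
  Slice (pb1 f (slice_map x)).
Definition wsub_reidx (A B : C) (f : hom A B) (x : wsub B) : wsub A :=
  \pi_(wsub A)%qT (slice_reidx f (repr x)).

Lemma slice_le_reidx (A B : C) (f : hom A B) (x : slice A) (y : slice B) :
  slice_le x (slice_reidx f y) = slice_le (Slice (f ∘ slice_map x)) y.
Proof.
have [sq up] := pbP f (slice_map y).
apply/asboolP/asboolP => /= -[k kE].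
  by exists (pb2 _ _ ∘ k); rewrite compA -sq -compA kE.
have [m [[m1 m2] _]] := up _ (slice_map x) k (esym kE).
by exists m.
Qed.

Lemma wsub_le_reidx (A B : C) (f : hom A B) (x : slice A) (y : wsub B) :
  (\pi_(wsub A)%qT x <= wsub_reidx f y) =
  (\pi_(wsub B)%qT (Slice (f ∘ slice_map x)) <= y).
Proof.
transitivity (slice_le x (slice_reidx f (repr y))); first exact: wsub_lepi.
rewrite slice_le_reidx -[in RHS](reprK y); exact/esym/wsub_lepi.
Qed.

Lemma wsub_le_ext (A : C) (x y : wsub A) :
  (forall z : slice A, (\pi_(wsub A)%qT z <= x) = (\pi_(wsub A)%qT z <= y)) ->
  x = y.
Proof.
move=> H; apply/le_anti/andP; split.
  by rewrite -(reprK x) -H reprK.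
by rewrite -(reprK y) H reprK.
Qed.

Definition weak_subobjects : lexDoctrine (Order.Disp tt tt) C.
Proof.
apply: (@LexDoctrine _ C (fun A => wsub A : tMeetSemilatticeType _) wsub_reidx).
- move=> A a; apply: wsub_le_ext => -[Z z].
  by rewrite wsub_le_reidx /= comp1m.
- move=> A B D g f a; apply: wsub_le_ext => -[Z z].
  by rewrite !wsub_le_reidx /= compA.
- by move=> A B f; apply: wsub_le_ext => z; rewrite wsub_le_reidx !lex1.
- move=> A B f x y; apply: wsub_le_ext => z.
  by rewrite lexI !wsub_le_reidx lexI.
Defined.

End WeakSubobjects.

(* Main.v *)
(** The equivalence of the conditions on C and on Psi_C does not involve P.
    Universal quantification in Psi_C is computed by weak dependent products,
    and a generic proof is the same thing as a predicate of Psi_C of which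
    every predicate is a reindexing; bottom and joins come from the
    second-order encodings of falsum and disjunction.  Conversely, if Psi_C is a
    tripos, a weak dependent product of f : X -> J along g : J -> I is a
    representative Z -> I x PX of the predicate "for all j over i there is x in
    U with f x = j"; a competing section e' is retrieved exactly because the
    name U of its graph determines it.

    The category of points inherits both structures from C: the predicate on a
    weak dependent product forces the evaluation to respect the given
    predicates, and a generic proof is indexed by a weak exponential of Lambda
    by an object of truth values of P.  In the other direction the forgetful
    functor preserves pullbacks, because the fibres have bottoms, and
    everything in C lifts to the points with predicate top. *)

From mathcomp Require Import all_boot all_order generic_quotient boolp.
Require Import Defs.

Set Implicit Arguments.
Unset Strict Implicit.
Unset Printing Implicit Defensive.

Import Order.TTheory.
Local Open Scope order_scope.
Local Open Scope category_scope.

(** * Pullbacks, products and weak exponentials *)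

Lemma pullback_ext (C : category) (A B D W : C) (f : hom A D) (g : hom B D)
    (p : hom W A) (q : hom W B) (V : C) (k k' : hom V W) :
  is_pullback f g p q -> p ∘ k = p ∘ k' -> q ∘ k = q ∘ k' -> k = k'.
Proof.
move=> [sq up] pk qk.
have [|m [_ mU]] := up V (p ∘ k) (q ∘ k); first by rewrite !compA sq.
by rewrite -(mU k) // (mU k').
Qed.

Section Products.
Variable C : lexCategory.

Lemma pair_ext (W X Y : C) (k k' : hom W (bprod X Y)) :
  pr1 X Y ∘ k = pr1 X Y ∘ k' -> pr2 X Y ∘ k = pr2 X Y ∘ k' -> k = k'.
Proof. by move=> e1 e2; rewrite (pairm_uniq k) e1 e2 -pairm_uniq. Qed.

Lemma pairm_comp (V W X Y : C) (u : hom W X) (v : hom W Y) (k : hom V W) :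
  pairm u v ∘ k = pairm (u ∘ k) (v ∘ k).
Proof. by apply: pair_ext; rewrite compA !(pr1_pairm, pr2_pairm). Qed.

Lemma prod_map_pairm (W X X' Y Y' : C) (f : hom X X') (g : hom Y Y')
    (u : hom W X) (v : hom W Y) :
  prod_map f g ∘ pairm u v = pairm (f ∘ u) (g ∘ v).
Proof.
by rewrite /prod_map pairm_comp -!compA pr1_pairm pr2_pairm.
Qed.

Lemma pr1_prod_map (X X' Y Y' : C) (f : hom X X') (g : hom Y Y') :
  pr1 X' Y' ∘ prod_map f g = f ∘ pr1 X Y.
Proof. by rewrite /prod_map pr1_pairm. Qed.

Lemma pr2_prod_map (X X' Y Y' : C) (f : hom X X') (g : hom Y Y') :
  pr2 X' Y' ∘ prod_map f g = g ∘ pr2 X Y.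
Proof. by rewrite /prod_map pr2_pairm. Qed.

Lemma bang_ext (A : C) (f g : hom A (termo C)) : f = g.
Proof. by rewrite (bang_uniq f) (bang_uniq g). Qed.

Lemma bprod_pullback (X Y : C) :
  is_pullback (bang X) (bang Y) (pr1 X Y) (pr2 X Y).
Proof.
split=> [|V u v _]; first exact: bang_ext.
exists (pairm u v); split; first by rewrite pr1_pairm pr2_pairm.
by move=> k [<- <-]; rewrite -pairm_uniq.
Qed.

(** A weak exponential is the weak dependent product of the projection [bprod L X -> X] along
    [X -> 1]: sections of that projection over [bprod X Y] are arrows [bprod X Y -> L]. *)
Lemma weak_exponential (X L : C) : weak_dependent_products C ->
  exists (Z : C) (ev : hom (bprod X Z) L),
    forall (Y : C) (b : hom (bprod X Y) L), exists chi : hom Y Z,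
      b = ev ∘ prod_map (idm X) chi.
Proof.
move=> wdp.
have [Z [E [h [p [q [e [[pbE fe] univ]]]]]]] := wdp _ _ _ (pr2 L X) (bang X).
have [|m [[pm qm] _]] := pbE.2 (bprod X Z) (pr1 X Z) (pr2 X Z).
  exact: bang_ext.
exists Z, (pr1 L X ∘ e ∘ m) => Y b.
have [|w [k [_ pk qk ek]]] := univ Y (bprod X Y) (bang Y) (pr1 X Y) (pr2 X Y)
  (pairm b (pr1 X Y)).
  by split; [exact: bprod_pullback | rewrite pr2_pairm].
exists w.
suff kE : k = m ∘ prod_map (idm X) w.
  by rewrite -!compA -kE -ek pr1_pairm.
apply: (pullback_ext pbE).
  by rewrite compA pm pr1_prod_map comp1m.
by rewrite compA qm pr2_prod_map.
Qed.

End Products.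

(** * Generic predicates and second-order encodings of the connectives *)

Section Doctrine.
Context (d : Order.disp_t) (C : lexCategory) (P : lexDoctrine d C).

Definition generic_predicate (L : C) (t : P L) : Prop :=
  forall (A : C) (x : P A), exists u : hom A L, x = reidx P u t.

Lemma reidx_le (A B : C) (f : hom A B) (x y : P B) :
  x <= y -> reidx P f x <= reidx P f y.
Proof. by move=> /meet_idPl xy; apply/meet_idPl; rewrite -reidxI xy. Qed.

(** Predicates on [A] are predicates on [1 x A], so membership for the power object of the terminal
    object is generic. *)
Lemma weak_power_generic_predicate :
  weak_power_objects P -> exists (L : C) (t : P L), generic_predicate t.
Proof.
move=> /(_ (termo C))[L [i iP]].
exists L, (reidx P (pairm (bang L) (idm L)) i) => A x.
have [chi xE] := iP A (reidx P (pr2 _ A) x).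
exists chi.
rewrite -reidx_comp pairm_comp comp1m.
have -> : pairm (bang L ∘ chi) chi =
    prod_map (idm _) chi ∘ pairm (bang A) (idm A).
  by rewrite prod_map_pairm compm1; congr pairm; exact: bang_ext.
by rewrite reidx_comp -xE -reidx_comp pr2_pairm reidx_id.
Qed.

(** A weak exponential of [L] by [X] serves as the power object, with [t] reindexed along evaluation
    as membership. *)
Lemma generic_predicate_weak_power (L : C) (t : P L) :
  weak_dependent_products C -> generic_predicate t -> weak_power_objects P.
Proof.
move=> wdp tP X; have [Z [ev evP]] := weak_exponential X L wdp.
exists Z, (reidx P ev t) => Y b.
have [u ->] := tP _ b; have [chi ->] := evP _ u.
by exists chi; rewrite reidx_comp.
Qed.

Section Existential.
Hypothesis exP : full_existential P.

(** Transposing along the left adjoint moves the inequality to [B], where Frobenius extracts [x]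
    from the image. *)
Lemma reidx_impl (A B : C) (f : hom A B) (x y z : P B) :
  is_impl x y z -> is_impl (reidx P f x) (reidx P f y) (reidx P f z).
Proof.
have [ex [adj _ frob]] := exP => zP w.
by rewrite -!adj zP meetC -frob meetC.
Qed.

Lemma reidx_join (A B : C) (f : hom A B) (al : P A -> P B) (x y z : P B) :
  adjoint (reidx P f) al ->
  is_join x y z -> is_join (reidx P f x) (reidx P f y) (reidx P f z).
Proof. by move=> adj zP w; rewrite !adj zP. Qed.

Lemma reidx_bottom (A B : C) (f : hom A B) (al : P A -> P B) (z : P B) :
  adjoint (reidx P f) al -> is_bottom z -> is_bottom (reidx P f z).
Proof. by move=> adj zP w; rewrite adj. Qed.

(* The mate of the Beck-Chevalley condition for the left adjoints. *)
Lemma forall_beck_chevalley (al : quantifier P) :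
  (forall (A B : C) (f : hom A B), adjoint (reidx P f) (al A B f)) ->
  beck_chevalley al.
Proof.
have [ex [adj bc _]] := exP => al_adj A B D W f g p q pbW a.
have pbT : is_pullback g f q p.
  split=> [|V u v uv]; first by rewrite pbW.1.
  have [k [[pk qk] kU]] := pbW.2 V v u (esym uv).
  by exists k; split=> // k' [qk' pk']; exact: kU.
have E w : (w <= reidx P g (al A D f a)) = (w <= al W B q (reidx P p a)).
  by rewrite -adj -al_adj (bc _ _ _ _ _ _ _ _ pbT) adj al_adj.
by apply/le_anti; rewrite -E lexx E lexx.
Qed.

Section SecondOrder.
Hypothesis allP : forall (A B : C) (f : hom A B) (a : P A),
  exists z : P B, forall y : P B, (reidx P f y <= a) = (y <= z).
Context (L : C) (t : P L).
Hypothesis tP : generic_predicate t.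

(* [x -> y] is the quantification of [y] along the comprehension of [x]. *)
Hypothesis comprehension : forall (A : C) (x : P A), exists (X : C) (m : hom X A),
  forall ex : P X -> P A, adjoint ex (reidx P m) -> ex \top = x.

Lemma comprehension_impl (A : C) (x y : P A) : exists z : P A, is_impl x y z.
Proof.
have [ex [adj _ frob]] := exP.
have [X [m mx]] := comprehension x.
have [z zP] := allP m (reidx P m y).
exists z => w.
(* By Frobenius, restricting [w] along [m] and taking the image gives the meet of [w] with the image
   of top, which is [x]. *)
by rewrite -zP -adj -(mx _ (adj _ _ m)) -frob meetx1.
Qed.

(** Specialization of a quantifier over [L] to the truth value [u]: reindex along the section
    [(id, u)] of the projection. *)
Lemma forall_prop_le (A : C) (s : P (bprod A L)) (z : P A) (u : hom A L) :
  (forall y : P A, (reidx P (pr1 A L) y <= s) = (y <= z)) ->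
  z <= reidx P (pairm (idm A) u) s.
Proof.
move=> zP; have /(reidx_le (pairm (idm A) u)) : reidx P (pr1 A L) z <= s.
  by rewrite zP.
by rewrite -reidx_comp pr1_pairm reidx_id.
Qed.

(** Falsum is encoded as [forall r, r]. *)
Lemma second_order_bottom (A : C) : exists z : P A, is_bottom z.
Proof.
have [z zP] := allP (pr1 A L) (reidx P (pr2 A L) t).
exists z => w; have [u ->] := tP w.
by have := forall_prop_le u zP; rewrite -reidx_comp pr2_pairm.
Qed.

(* [x \/ y] is [forall r, (x -> r) -> (y -> r) -> r]. *)
Lemma second_order_join (A : C) (x y : P A) : exists z : P A, is_join x y z.
Proof.
pose r := reidx P (pr2 A L) t.
have [i iP] := comprehension_impl (reidx P (pr1 A L) x) r.
have [j jP] := comprehension_impl (reidx P (pr1 A L) y) r.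
have [s sP] := comprehension_impl (i `&` j) r.
have [z zP] := allP (pr1 A L) s.
have xz : x <= z.
  rewrite -zP sP; apply: le_trans (_ : i `&` reidx P (pr1 A L) x <= _).
    by rewrite lexI leIl andbT leIxr // leIl.
  by rewrite -iP.
have yz : y <= z.
  rewrite -zP sP; apply: le_trans (_ : j `&` reidx P (pr1 A L) y <= _).
    by rewrite lexI leIl andbT leIxr // leIr.
  by rewrite -jP.
exists z => w; apply/idP/andP => [zw|[xw yw]].
  by rewrite (le_trans xz) // (le_trans yz).
(* With [r] instantiated at [w], both premises become top, so the encoding collapses to [w]. *)
have [u wE] := tP w; apply: le_trans (forall_prop_le u zP) _.
set v := pairm (idm A) u.
have v1 b : reidx P v (reidx P (pr1 A L) b) = b.
  by rewrite -reidx_comp pr1_pairm reidx_id.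
have rw : reidx P v r = w by rewrite -reidx_comp pr2_pairm.
have top_impl (b : P A) (l : P (bprod A L)) :
    is_impl (reidx P (pr1 A L) b) r l -> b <= w -> reidx P v l = \top.
  move=> /(reidx_impl v) lP bw; apply/eqP.
  by rewrite -le1x lP v1 rw meet1x.
have := reidx_impl v sP (reidx P v s).
by rewrite lexx reidxI (top_impl _ _ iP xw) (top_impl _ _ jP yw) !meetx1 rw.
Qed.

Lemma second_order_hyperdoctrine : full_hyperdoctrine P.
Proof.
have [al al_adj] : exists al : quantifier P,
    forall (A B : C) (f : hom A B), adjoint (reidx P f) (al A B f).
  exists (fun A B f a => projT1 (cid (allP f a))) => A B f y a.
  by case: cid.
split=> //.
- move=> A; split; first exact: second_order_bottom.
    exact: second_order_join.
  exact: comprehension_impl.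
- move=> A B f; split.
  + exact: reidxT.
  + exact: reidxI.
  + by move=> z; exact: (reidx_bottom (al_adj _ _ f)).
  + by move=> x y z; exact: (reidx_join (al_adj _ _ f)).
  + by move=> x y z; exact: reidx_impl.
- by exists al; split=> //; exact: forall_beck_chevalley.
Qed.

End SecondOrder.
End Existential.
End Doctrine.

(** * The weak subobject doctrine and weak dependent products *)

Section WeakSubobjects.
Variable C : lexCategory.
Local Notation Psi := (weak_subobjects C).

Definition wsub_of (A X : C) (f : hom X A) : Psi A := \pi_(wsub A)%qT (Slice f).

Lemma wsub_ofP (A : C) (x : Psi A) :
  exists (X : C) (f : hom X A), x = wsub_of f.
Proof.
exists (slice_ob (repr x)), (slice_map (repr x)).
by rewrite -[LHS]reprK /wsub_of; case: (repr x).
Qed.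

Lemma wsub_of_le (A X Y : C) (f : hom X A) (g : hom Y A) :
  (wsub_of f <= wsub_of g) <-> exists k : hom X Y, g ∘ k = f.
Proof.
have -> : (wsub_of f <= wsub_of g) = slice_le (Slice f) (Slice g).
  exact: wsub_lepi.
by split=> /asboolP.
Qed.

Lemma wsub_of_le_reidx (A B X : C) (f : hom A B) (x : hom X A) (y : Psi B) :
  (wsub_of x <= reidx Psi f y) = (wsub_of (f ∘ x) <= y).
Proof. exact: wsub_le_reidx. Qed.

Lemma wsub_of_ext (A : C) (x y : Psi A) :
  (forall (X : C) (z : hom X A), (wsub_of z <= x) <-> (wsub_of z <= y)) ->
  x = y.
Proof.
by move=> E; apply: wsub_le_ext => -[X z]; apply/idP/idP => /E.
Qed.

Lemma reidx_wsub_of (A B D W : C) (f : hom A D) (g : hom B D)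
    (p : hom W A) (q : hom W B) :
  is_pullback f g p q -> reidx Psi f (wsub_of g) = wsub_of p.
Proof.
move=> pbW; apply: wsub_of_ext => X z.
rewrite wsub_of_le_reidx !wsub_of_le; split=> [[k gk]|[k <-]].
  by have [m [[pm _] _]] := pbW.2 X z k (esym gk); exists m.
by exists (q ∘ k); rewrite !compA pbW.1.
Qed.

Definition wsub_ex (A B : C) (f : hom A B) (a : Psi A) : Psi B :=
  wsub_of (f ∘ slice_map (repr a)).

Lemma wsub_ex_adjoint (A B : C) (f : hom A B) :
  adjoint (wsub_ex f) (reidx Psi f).
Proof.
move=> a b; rewrite -wsub_of_le_reidx.
have -> // : wsub_of (slice_map (repr a)) = a.
by rewrite -[RHS]reprK /wsub_of; case: (repr a).
Qed.

Lemma wsub_ex_of (A B X : C) (f : hom A B) (x : hom X A) :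
  wsub_ex f (wsub_of x) = wsub_of (f ∘ x).
Proof.
have E y : (wsub_ex f (wsub_of x) <= y) = (wsub_of (f ∘ x) <= y).
  by rewrite wsub_ex_adjoint wsub_of_le_reidx.
by apply/le_anti; rewrite E lexx -E lexx.
Qed.

(** One half of each law is formal from adjointness; the other is checked on a representative [y].
    For Beck-Chevalley the pullback property factors [y] through [q]; for Frobenius [x ∘ k] lifts
    [y] along [f]. *)
Lemma weak_subobjects_existential : full_existential Psi.
Proof.
exists wsub_ex; split; first exact: wsub_ex_adjoint.
- move=> A B D W f g p q pbW a.
  have [X [x ->]] := wsub_ofP a; apply/le_anti/andP; split; last first.
    rewrite wsub_ex_adjoint -reidx_comp -pbW.1 reidx_comp reidx_le //.
    by rewrite -wsub_ex_adjoint.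
  have [Y [y yE]] := wsub_ofP (reidx Psi g (wsub_ex f (wsub_of x))).
  have yx : wsub_of y <= reidx Psi g (wsub_ex f (wsub_of x)) by rewrite yE.
  rewrite {}yE; move: yx; rewrite wsub_of_le_reidx wsub_ex_of => /wsub_of_le[k].
  rewrite -compA => xk; have [m [[pm <-] _]] := pbW.2 Y _ _ xk.
  rewrite -wsub_ex_of wsub_ex_adjoint; apply: le_trans (_ : reidx Psi p _ <= _).
    by rewrite wsub_of_le_reidx pm; apply/wsub_of_le; exists k.
  by rewrite -wsub_ex_adjoint.
- move=> A B f a b; apply/le_anti/andP; split.
    rewrite wsub_ex_adjoint reidxI lexI leIl /=.
    by rewrite leIxr // -wsub_ex_adjoint.
  have [X [x ->]] := wsub_ofP a.
  have [Y [y yE]] := wsub_ofP (b `&` wsub_ex f (wsub_of x)).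
  have yx : wsub_of y <= b `&` wsub_ex f (wsub_of x) by rewrite yE.
  rewrite {}yE; move: yx; rewrite wsub_ex_of lexI => /andP[yb /wsub_of_le[k xk]].
  rewrite -xk -compA -wsub_of_le_reidx.
  apply: le_trans (_ : reidx Psi f b `&` wsub_of x <= _).
    rewrite lexI wsub_of_le_reidx compA xk yb /=.
    by apply/wsub_of_le; exists k.
  by rewrite -wsub_ex_adjoint.
Qed.

Lemma generic_predicate_of_proof : has_generic_proof C ->
  exists (L : C) (t : Psi L), generic_predicate t.
Proof.
move=> [Theta [L [theta gen]]]; exists L, (wsub_of theta) => A x.
have [Y [f ->]] := wsub_ofP x.
have [u [E [p [q [pbE [k fk] [l pl]]]]]] := gen Y A f.
exists u; rewrite (reidx_wsub_of pbE); apply/le_anti/andP.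
by split; apply/wsub_of_le; [exists k | exists l].
Qed.

Lemma generic_proof_of_predicate (L : C) (t : Psi L) :
  generic_predicate t -> has_generic_proof C.
Proof.
have [Theta [theta ->]] := wsub_ofP t => gen.
exists Theta, L, theta => Y X f.
have [u] := gen X (wsub_of f).
rewrite (reidx_wsub_of (pbP u theta)) => /eqP; rewrite eq_le => /andP[].
move=> /wsub_of_le[k fk] /wsub_of_le[l pl].
exists u, (pb u theta), (pb1 u theta), (pb2 u theta).
by split; [exact: pbP | exists k | exists l].
Qed.

(** A factorization through [f] of the pullback of [h'] along [g] is exactly competing data, so it
    exists iff [h'] factors through the weak dependent product [h]. *)
Lemma weak_subobjects_forall (wdp : weak_dependent_products C) (J I : C)
    (g : hom J I) (a : Psi J) :
  exists z : Psi I, forall y : Psi I, (reidx Psi g y <= a) = (y <= z).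
Proof.
have [X [f ->]] := wsub_ofP a.
have [Z [E [h [p [q [e [[pbE fe] univ]]]]]]] := wdp X J I f g.
exists (wsub_of h) => y; have [Z' [h' ->]] := wsub_ofP y.
have pbE' := pbP g h'; rewrite (reidx_wsub_of pbE').
apply/idP/idP => /wsub_of_le.
  move=> [e' fe']; apply/wsub_of_le.
  by have [w [k [hw _ _ _]]] := univ _ _ _ _ _ _ (conj pbE' fe'); exists w.
move=> [w hw]; apply/wsub_of_le.
have [|m [[pm _] _]] := pbE.2 _ (pb1 g h') (w ∘ pb2 g h').
  by rewrite pbE'.1 compA hw.
by exists (e ∘ m); rewrite compA fe.
Qed.

Lemma weak_subobjects_tripos :
  weak_dependent_products C -> has_generic_proof C -> full_tripos Psi.
Proof.
move=> wdp /generic_predicate_of_proof[L [t tP]]; split; last first.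
  exact: generic_predicate_weak_power tP.
apply: (second_order_hyperdoctrine _ _ tP).
- exact: weak_subobjects_existential.
- exact: weak_subobjects_forall.
(* Any representative is a comprehension: a left adjoint sends top, the class of the identity, to
   the class of [m]. *)
- move=> A x; have [X [m ->]] := wsub_ofP x.
  exists X, m => ex adj.
  have E y : (ex \top <= y) = (wsub_of m <= y).
    by rewrite adj -[m]compm1 -wsub_of_le_reidx compm1.
  by apply/le_anti; rewrite E lexx -E lexx.
Qed.

(* [Z -> bprod I PX] represents the pairs [(i, U)] such that every [j] over [i]
   has some [x] in [U] with [f x = j]. *)
Lemma tripos_weak_dependent_products :
  full_tripos Psi -> weak_dependent_products C.
Proof.
move=> [[_ _ _ [al [adj _]]] wpo] X J I f g.
have [PX [inX inXP]] := wpo X.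
have [M [m mE]] := wsub_ofP inX; rewrite {}mE in inXP.
(* [n] represents the pairs [(j, U)] such that some [x] in [U] has [f x = j]. *)
pose n := prod_map f (idm PX) ∘ m.
pose G := prod_map g (idm PX).
have [Z [h hE]] := wsub_ofP (al _ _ G (wsub_of n)).
pose h1 := pr1 I PX ∘ h; pose h2 := pr2 I PX ∘ h.
pose E := pb g h1; pose p : hom E J := pb1 g h1; pose q : hom E Z := pb2 g h1.
have pbE : is_pullback g h1 p q by exact: pbP.
have Gn : reidx Psi G (wsub_of h) <= wsub_of n by rewrite adj hE.
(* The counit of the adjunction provides the witnesses in [M]; their [X]-components form the
   evaluation [e]. *)
have [s ns] : exists s : hom E M, n ∘ s = pairm p (h2 ∘ q).
  apply/wsub_of_le; apply: le_trans Gn; rewrite wsub_of_le_reidx.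
  apply/wsub_of_le; exists q; rewrite /G prod_map_pairm comp1m.
  apply: pair_ext; first by rewrite pr1_pairm pbE.1 compA.
  by rewrite pr2_pairm compA.
pose e := pr1 X PX ∘ m ∘ s.
have fe : f ∘ e = p.
  move: (congr1 (compm (pr1 J PX)) ns).
  by rewrite pr1_pairm /n /e !compA pr1_prod_map.
have es : m ∘ s = pairm e (h2 ∘ q).
  apply: pair_ext; first by rewrite pr1_pairm /e !compA.
  move: (congr1 (compm (pr2 J PX)) ns).
  by rewrite !pr2_pairm /n !compA pr2_prod_map comp1m.
exists Z, E, h1, p, q, e; split; first by [].
move=> Z' E' h' p' q' e' [pbE' fe'].
(* [chi] names, for each [z] in [Z'], the set of values of [e'] on the fibre of [q'] over [z]. *)
have [chi chiP] := inXP Z' (wsub_of (pairm e' q')).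
have [s' ms'] : exists s' : hom E' M, m ∘ s' = pairm e' (chi ∘ q').
  apply/wsub_of_le.
  have -> : pairm e' (chi ∘ q') = prod_map (idm X) chi ∘ pairm e' q'.
    by rewrite prod_map_pairm comp1m.
  by rewrite -wsub_of_le_reidx -chiP.
(* By adjunction, it suffices that the set named by [chi] meets the fibre of [f] over each relevant
   [j]; [s'] provides the element. *)
have [w hw] : exists w : hom Z' Z, h ∘ w = pairm h' chi.
  apply/wsub_of_le; rewrite -hE -adj.
  have [Y [y yE]] := wsub_ofP (reidx Psi G (wsub_of (pairm h' chi))).
  have := lexx (wsub_of y); rewrite -{2}yE wsub_of_le_reidx => /wsub_of_le[r].
  rewrite pairm_comp => rE.
  have r1 : h' ∘ r = g ∘ (pr1 J PX ∘ y).
    move: (congr1 (compm (pr1 I PX)) rE).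
    by rewrite pr1_pairm !compA pr1_prod_map.
  have r2 : chi ∘ r = pr2 J PX ∘ y.
    move: (congr1 (compm (pr2 I PX)) rE).
    by rewrite pr2_pairm !compA pr2_prod_map comp1m.
  have [k [[pk qk] _]] := pbE'.2 _ _ _ (esym r1).
  rewrite yE; apply/wsub_of_le; exists (s' ∘ k).
  rewrite /n -compA (compA m) ms' pairm_comp prod_map_pairm comp1m.
  apply: pair_ext; first by rewrite pr1_pairm compA fe' pk.
  by rewrite pr2_pairm -compA qk.
have w1 : h1 ∘ w = h' by rewrite /h1 -compA hw pr1_pairm.
have w2 : h2 ∘ w = chi by rewrite /h2 -compA hw pr2_pairm.
have [|k [[pk qk] _]] := pbE.2 E' p' (w ∘ q').
  by rewrite pbE'.1 compA w1.
exists w, k; split=> //.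
(* The values of [e ∘ k] belong to the sets named by [chi], so they are values of [e'] at points
   [c]. Since [c] commutes with both projections of [E'], it is the identity. *)
have [c cE] : exists c, pairm e' q' ∘ c = pairm (e ∘ k) q'.
  apply/wsub_of_le; rewrite chiP wsub_of_le_reidx; apply/wsub_of_le.
  exists (s ∘ k); rewrite prod_map_pairm compA es pairm_comp comp1m.
  by congr pairm; rewrite -compA qk compA w2.
move: cE; rewrite pairm_comp => cE.
have c1 : e' ∘ c = e ∘ k.
  by move: (congr1 (compm (pr1 X Z')) cE); rewrite !pr1_pairm.
have c2 : q' ∘ c = q'.
  by move: (congr1 (compm (pr2 X Z')) cE); rewrite !pr2_pairm.
suff c_id : c = idm E' by rewrite -c1 c_id compm1.
apply: (pullback_ext pbE'); last by rewrite c2 compm1.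
by rewrite compm1 -fe' -compA c1 compA fe pk.
Qed.

End WeakSubobjects.

(** * Transfer between the base category and the category of points *)

Section Points.
Context (d : Order.disp_t) (C : lexCategory) (P : lexDoctrine d C).

Definition point_arrow (a b : points P) (f : hom (tag a) (tag b))
    (fP : tagged a <= reidx P f (tagged b)) : hom a b :=
  exist (fun f : hom _ _ => _ <= reidx P f _) f fP.

Definition point (A : C) (x : P A) : points P := existT _ A x.

Definition point_top (A : C) : points P := point (\top : P A).

Definition point_top_arrow (A B : C) (f : hom A B) :
  hom (point_top A) (point_top B).
Proof.
by apply: (@point_arrow (point_top A) (point_top B) f); rewrite /= reidxT.
Defined.

(** The reverse of the assumed inequality is automatic, [p] and [q] being arrows of points: the
    predicate on a pullback is the meet of the reindexed ones. *)
Lemma points_pullback (a b c w : points P) (f : hom a c) (g : hom b c)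
    (p : hom w a) (q : hom w b) :
  is_pullback (val f) (val g) (val p) (val q) ->
  reidx P (val p) (tagged a) `&` reidx P (val q) (tagged b) <= tagged w ->
  is_pullback f g p q.
Proof.
move=> [sq up] le_w; split=> [|v x y xy]; first exact: val_inj.
have [k [[pk qk] kU]] := up _ _ _ (congr1 val xy).
have kP : tagged v <= reidx P k (tagged w).
  apply: le_trans (reidx_le k le_w).
  by rewrite reidxI -!reidx_comp pk qk lexI (valP x) (valP y).
exists (point_arrow kP); split; first by split; apply: val_inj.
move=> k' [pk' qk']; apply: val_inj; apply: kU.
by split; [rewrite -pk' | rewrite -qk'].
Qed.

(** Every arrow of [C] out of [V] lifts to an arrow of points out of [V] with the bottom predicate,
    so cones in [C] can be tested in the points. *)
Lemma points_pullback_val (a b c w : points P) (f : hom a c) (g : hom b c)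
    (p : hom w a) (q : hom w b) :
  (forall A : C, exists z : P A, is_bottom z) ->
  is_pullback f g p q -> is_pullback (val f) (val g) (val p) (val q).
Proof.
move=> bot [sq up]; split=> [|V u v uv]; first exact: (congr1 val sq).
have [z zP] := bot V.
pose V0 : points P := point z.
pose lift (e : points P) (k : hom V (tag e)) : hom V0 e :=
  @point_arrow V0 e k (zP _).
have [|k [[pk qk] kU]] := up V0 (lift a u) (lift b v); first exact: val_inj.
exists (val k); split.
  by split; [exact: (congr1 val pk) | exact: (congr1 val qk)].
move=> k' [pk' qk'].
by rewrite (kU (lift w k')) //; split; apply: val_inj.
Qed.

(** Testing against the same object with the meet as predicate yields a comparison arrow whose
    underlying arrow is the identity. *)
Lemma points_pullback_le (a b c w : points P) (f : hom a c) (g : hom b c)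
    (p : hom w a) (q : hom w b) :
  is_pullback (val f) (val g) (val p) (val q) -> is_pullback f g p q ->
  reidx P (val p) (tagged a) `&` reidx P (val q) (tagged b) <= tagged w.
Proof.
move=> pbW [sq up].
pose V : points P :=
  point (reidx P (val p) (tagged a) `&` reidx P (val q) (tagged b)).
have uP : tagged V <= reidx P (val p) (tagged a) by exact: leIl.
have vP : tagged V <= reidx P (val q) (tagged b) by exact: leIr.
have [|k [[pk qk] _]] := up V (point_arrow uP) (point_arrow vP).
  by apply: val_inj; exact: pbW.1.
suff k_id : val k = idm (tag w) by have := valP k; rewrite k_id reidx_id.
apply: (pullback_ext pbW).
  by rewrite compm1; exact: (congr1 val pk).
by rewrite compm1; exact: (congr1 val qk).
Qed.

Lemma point_top_pullback (A B D W : C) (f : hom A D) (g : hom B D)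
    (p : hom W A) (q : hom W B) :
  is_pullback f g p q ->
  is_pullback (point_top_arrow f) (point_top_arrow g) (point_top_arrow p)
    (point_top_arrow q).
Proof. by move=> pbW; apply: points_pullback => //=; exact: lex1. Qed.

Section Forget.
Hypothesis bot : forall A : C, exists z : P A, is_bottom z.

Lemma weak_dependent_products_of_points :
  weak_dependent_products (points P) -> weak_dependent_products C.
Proof.
move=> wdp X J I f g.
have [Z [E [h [p [q [e [[pbE fe] univ]]]]]]] :=
  wdp _ _ _ (point_top_arrow f) (point_top_arrow g).
exists (tag Z), (tag E), (val h), (val p), (val q), (val e); split.
  by split; [exact: points_pullback_val pbE | exact: (congr1 val fe)].
move=> Z' E' h' p' q' e' [pbE' fe'].
have [|w [k [hw pk qk ek]]] := univ (point_top Z') (point_top E')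
  (point_top_arrow h') (point_top_arrow p') (point_top_arrow q')
  (point_top_arrow e').
  by split; [exact: point_top_pullback | apply: val_inj].
exists (val w), (val k); split.
- exact: (congr1 val hw).
- exact: (congr1 val pk).
- exact: (congr1 val qk).
- exact: (congr1 val ek).
Qed.

Lemma generic_proof_of_points :
  has_generic_proof (points P) -> has_generic_proof C.
Proof.
move=> [Theta [L [theta gen]]]; exists (tag Theta), (tag L), (val theta).
move=> Y X f.
have [u [E [p [q [pbE [k fk] [l pl]]]]]] := gen _ _ (point_top_arrow f).
exists (val u), (tag E), (val p), (val q); split.
- exact: points_pullback_val pbE.
- by exists (val k); exact: (congr1 val fk).
- by exists (val l); exact: (congr1 val pl).
Qed.

End Forget.

Lemma points_weak_dependent_products :
  full_hyperdoctrine P -> weak_dependent_products C ->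
  weak_dependent_products (points P).
Proof.
move=> [exP hey _ [al [adj bc]]] wdp X J I f g.
have [Z [E [h [p [q [e [[pbE fe] univ]]]]]]] := wdp _ _ _ (val f) (val g).
have [_ _ impl] := hey E.
have [r rP] := impl (reidx P p (tagged J)) (reidx P e (tagged X)).
(* The second conjunct restricts to the [z] at which evaluation carries the predicate of [J] into
   that of [X]. *)
pose Z0 := point (reidx P h (tagged I) `&` al _ _ q r).
pose E0 := point (reidx P p (tagged J) `&` reidx P q (tagged Z0)).
have hP : tagged Z0 <= reidx P h (tagged I) by exact: leIl.
have pP : tagged E0 <= reidx P p (tagged J) by exact: leIl.
have qP : tagged E0 <= reidx P q (tagged Z0) by exact: leIr.
have eP : tagged E0 <= reidx P e (tagged X).
  rewrite /= meetC -rP reidxI leIxr //.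
  by rewrite adj.
exists Z0, E0, (@point_arrow Z0 I h hP), (@point_arrow E0 J p pP),
  (@point_arrow E0 Z0 q qP), (@point_arrow E0 X e eP).
split; first by split; [apply: points_pullback | apply: val_inj].
move=> Z' E' h' p' q' e' [pbE' fe'].
have bot (A : C) : exists z : P A, is_bottom z by have [] := hey A.
have pbC := points_pullback_val bot pbE'.
have leE' := points_pullback_le pbC pbE'.
have [w [k [hw pk qk ek]]] := univ _ _ _ _ _ _ (conj pbC (congr1 val fe')).
(* By pullback cancellation [E'] is also the pullback of [q] along [w], so Beck-Chevalley moves the
   quantifier along [q] to one along [q']. *)
have pbk : is_pullback q w k (val q').
  split=> // V x y xy.
  have [|m [[pm qm] mU]] := pbC.2 V (p ∘ x) y.
    by rewrite compA pbE.1 -compA xy compA -hw.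
  exists m; split.
    split=> //; apply: (pullback_ext pbE); first by rewrite compA pk.
    by rewrite compA qk -compA qm.
  by move=> m' [km' qm']; apply: mU; rewrite -km' compA pk.
have wP : tagged Z' <= reidx P w (tagged Z0).
  rewrite /= reidxI lexI -reidx_comp -hw (valP h') /=.
  rewrite (bc _ _ _ _ _ _ _ _ pbk) -adj (reidx_impl exP k rP).
  by rewrite -!reidx_comp pk -ek meetC (le_trans leE' (valP e')).
have kP : tagged E' <= reidx P k (tagged E0).
  rewrite reidxI lexI -!reidx_comp pk (valP p') qk reidx_comp /=.
  exact: le_trans (valP q') (reidx_le _ wP).
exists (@point_arrow Z' Z0 w wP), (@point_arrow E' E0 k kP).
by split; apply: val_inj.
Qed.

(* Over [X], the point [(Y, eta)] is equivalent to the class of the arrow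
   [Y -> Sigma * X] whose first component is the name of [eta]. *)
Lemma points_generic_proof (Sigma : C) (t : P Sigma) :
  generic_predicate t -> weak_dependent_products C -> has_generic_proof C ->
  has_generic_proof (points P).
Proof.
move=> tP wdp [Theta [L [theta gen]]].
have [Z [ev evP]] := weak_exponential Sigma L wdp.
pose a := pb1 ev theta; pose b := pb2 ev theta.
have pbT : is_pullback ev theta a b by exact: pbP.
(* A proof over [z] is a truth value [sigma] satisfying [t], together with an element of [Theta]
   over [ev (sigma, z)]. *)
pose T0 := point (reidx P (pr1 Sigma Z ∘ a) t).
exists T0, (point_top Z).
have thetaP : tagged T0 <= reidx P (pr2 Sigma Z ∘ a) \top.
  by rewrite reidxT lex1.
exists (@point_arrow T0 (point_top Z) _ thetaP) => Y X f.
have [chi chiE] := tP _ (tagged Y).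
have [u [E [p [q [pbE [k fk] [l pl]]]]]] := gen _ _ (pairm chi (val f)).
have [v uE] := evP _ u.
have [m [[am bm] _]] : exists! m : hom E _,
    a ∘ m = prod_map (idm Sigma) v ∘ p /\ b ∘ m = q.
  by apply: pbT.2; rewrite compA -uE pbE.1.
pose x := pr2 Sigma (tag X) ∘ p.
have vx : v ∘ x = pr2 Sigma Z ∘ a ∘ m.
  by rewrite -compA am compA pr2_prod_map -compA.
(* Although [E] was obtained over [bprod Sigma X], its projection to [X] is the pullback along [v]
   of the projected generic arrow: the missing [Sigma]-component is read off from [a ∘ z]. *)
have pbx : is_pullback v (pr2 Sigma Z ∘ a) x m.
  split=> // V y z yz.
  pose c := pairm (pr1 Sigma Z ∘ a ∘ z) y.
  have cE : prod_map (idm Sigma) v ∘ c = a ∘ z.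
    rewrite /c prod_map_pairm comp1m yz.
    by apply: pair_ext; rewrite ?pr1_pairm ?pr2_pairm !compA.
  have [|n [[pn qn] nU]] := pbE.2 V c (b ∘ z).
    by rewrite uE -compA cE !compA pbT.1.
  exists n; split.
    split; first by rewrite /x -compA pn pr2_pairm.
    apply: (pullback_ext pbT); first by rewrite compA am -compA pn.
    by rewrite compA bm.
  move=> n' [xn mn]; apply: nU; split; last by rewrite -mn compA bm.
  apply: pair_ext; last by rewrite pr2_pairm compA.
  by rewrite pr1_pairm -mn -!compA (compA a) am !compA pr1_prod_map comp1m.
have tm : reidx P m (tagged T0) = reidx P (pr1 _ _ ∘ p) t.
  by rewrite -reidx_comp -compA am compA pr1_prod_map comp1m.
pose E0 := point (reidx P x (tagged X) `&` reidx P m (tagged T0)).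
have vP : tagged X <= reidx P v \top by rewrite reidxT lex1.
have xP : tagged E0 <= reidx P x (tagged X) by exact: leIl.
have mP : tagged E0 <= reidx P m (tagged T0) by exact: leIr.
have kP : tagged Y <= reidx P k (tagged E0).
  rewrite reidxI lexI tm -!reidx_comp /x -!compA -fk pr1_pairm pr2_pairm.
  by rewrite (valP f) chiE /=.
(* [pairm chi (val f) ∘ l = p] identifies [chi ∘ l] with the [Sigma]-component of [p], so [t] there
   is the predicate of [Y] reindexed along [l]. *)
have lP : tagged E0 <= reidx P l (tagged Y).
  by rewrite /= tm chiE -reidx_comp pl compA pr1_pairm leIr.
exists (@point_arrow X (point_top Z) v vP), E0, (@point_arrow E0 X x xP),
  (@point_arrow E0 T0 m mP).
split; first exact: points_pullback.
  exists (@point_arrow Y E0 k kP); apply: val_inj => /=.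
  by rewrite /x -compA -fk pr2_pairm.
exists (@point_arrow E0 Y l lP); apply: val_inj => /=.
by rewrite /x pl compA pr2_pairm.
Qed.

End Points.

Theorem corollary7p6 (d : Order.disp_t) (C : lexCategory) (P : lexDoctrine d C)
    (tripos_P : full_tripos P) :
  [<-> ex_supercompactifiable P;
       weak_dependent_products C /\ has_generic_proof C;
       full_tripos (weak_subobjects C)].
Proof.
have [hypP /weak_power_generic_predicate[Sigma [t tP]]] := tripos_P.
have bot (A : C) : exists z : P A, is_bottom z.
  by have [_ /(_ A)[]] := hypP.
tfae.
- move=> [wdp gen]; split; first exact: weak_dependent_products_of_points.
  exact: generic_proof_of_points.
- by move=> [wdp gen]; exact: weak_subobjects_tripos.
- move=> tripos_Psi; have wdp := tripos_weak_dependent_products tripos_Psi.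
  have [L [s sP]] := weak_power_generic_predicate tripos_Psi.2.
  split; first exact: points_weak_dependent_products.
  exact: points_generic_proof tP wdp (generic_proof_of_predicate sP).
Qed.
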